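(* For every bipartite quantum state $\rho_{AB}$ on $\mathcal H_A\otimes\mathcal H_B$, $$\overset{c}{H}_{\min}(A|B)_\rho=-\log\Bigl(d_A\max_T F_T(\rho_{AB})\Bigr),\qquad F_T(\rho_{AB}):=\langle\Omega_{AA'}|(\mathrm{Id}_A\otimes T)(\rho_{AB})|\Omega_{AA'}\rangle,$$ where the maximum is taken over all efficiently implementable quantum channels $T:B\to A'$.
   Context: All Hilbert spaces are finite-dimensional and $\log$ is base $2$. Fix a finite gate set $\mathcal G$ (each gate is a unitary acting on a bounded number of registers) and a polynomial $p$. For a fixed $n$, $A$ and $B$ are systems consisting of registers (their sizes may depend on $n$), $d_A=\dim\mathcal H_A$, $A'\cong A$, and $|\Omega_{AA'}\rangle=\frac1{\sqrt{d_A}}\sum_{x=1}^{d_A}|x\rangle_A|x\rangle_{A'}$ in the computational basis. For a quantum channel (CPTP map) $T:\mathcal B(\mathcal H_B)\to\mathcal B(\mathcal H_{A'})$, $T^*$ denotes its adjoint, $\mathrm{Tr}[T(\rho)X]=\mathrm{Tr}[\rho\,T^*(X)]$, which is completely positive and unital. The gate complexity $C(T)$ is the minimal number of gates from $\mathcal G$ in a unitary circuit $U:\mathcal H_B\otimes\mathcal H_E\to\mathcal H_{A'}\otimes\mathcal H_K$ (for some ancillary systems $E,K$ with $\dim B\dim E=\dim A'\dim K$) such that $T(\rho)=\mathrm{tr}_K[U(\rho\otimes|0\rangle\langle0|_E)U^*]$ for all $\rho$. $T$ is efficiently implementable if $C(T)\le p(n)$. The Choi operator is $J(T^* ):=d_A(\mathrm{Id}_A\otimes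 T^* )(|\Omega_{AA'}\rangle\langle\Omega_{AA'}|)$, an operator on $AB$. Let $\mathbf J:=\{J(T^* ):C(T)\le p(n)\}$ and let $\mathcal C^{E}:=\mathrm{cone}(\mathbf J)$ be the smallest convex cone containing $\mathbf J$. Standing assumption (informational completeness): $\mathrm{span}_{\mathbb R}\mathbf J=\{X\text{ Hermitian on }AB:\mathrm{tr}_A[X]\in\mathbb R\cdot\mathbb 1_B\}$. For Hermitian $X,Y$ on $AB$ write $X\le_{S}Y$ iff $\mathrm{Tr}[XF]\le\mathrm{Tr}[YF]$ for all $F\in\mathcal C^{E}$ (the order induced by the dual cone). The computational max-divergence is $\overset{c}{D}{}^{A|B}_{\max}(\rho_{AB}\|\sigma_{AB}):=\inf\{\lambda\in\mathbb R:\rho_{AB}\le_S 2^\lambda\sigma_{AB}\}$ (with $\inf\emptyset=+\infty$), and the computational conditional min-entropy is $$\overset{c}{H}_{\min}(A|B)_\rho:=-\inf_{\sigma_B\ge0,\ \mathrm{Tr}[\sigma_B]=1}\overset{c}{D}{}^{A|B}_{\max}(\rho_{AB}\|\mathbb 1_A\otimes\sigma_B).$$ *)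

(* Defs.v *)
From HB Require Import structures.
From mathcomp Require Import all_boot all_order all_algebra.
From mathcomp Require Import spectral sesquilinear.
From mathcomp Require Import complex mxtens.
From mathcomp Require Import all_classical all_reals all_analysis.

Set Implicit Arguments.
Unset Strict Implicit.
Unset Printing Implicit Defensive.

Import Order.TTheory GRing.Theory Num.Theory.
Import ComplexField.
Local Open Scope classical_set_scope.
Local Open Scope complex_scope.
Local Open Scope ring_scope.
Local Open Scope sesquilinear_scope.

(** Operators on C^m are matrices ['M[R[i]]_m] acting on column vectors; the
    tensor product is the Kronecker product [*t] of [mxtens], whose index type
    ['I_(m * k)] is in bijection with pairs through [mxtens_index]. *)

Definition psd (R : realType) (m : nat) (X : 'M[R[i]]_m) : Prop :=
  forall v : 'cV[R[i]]_m, 0 <= (v ^t* *m X *m v) 0 0.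

Definition density (R : realType) (m : nat) : set 'M[R[i]]_m :=
  [set X | psd X /\ \tr X = 1].

(* The (i, j) block of an operator on C^m (x) C^k, the row and column of blocks
   being indexed by the first tensor factor. *)
Definition block (R : realType) (m k : nat) (X : 'M[R[i]]_(m * k))
    (i j : 'I_m) : 'M[R[i]]_k :=
  \matrix_(a, b) X (mxtens_index (i, a)) (mxtens_index (j, b)).

Definition ptrace1 (R : realType) (m k : nat) (X : 'M[R[i]]_(m * k)) :
    'M[R[i]]_k :=
  \sum_i block X i i.

Definition ptrace2 (R : realType) (m k : nat) (X : 'M[R[i]]_(m * k)) :
    'M[R[i]]_m :=
  \matrix_(i, j) \tr (block X i j).

Definition id_tens (R : realType) (m k l : nat)
    (T : 'M[R[i]]_k -> 'M[R[i]]_l) (X : 'M[R[i]]_(m * k)) : 'M[R[i]]_(m * l) :=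
  \sum_i \sum_j delta_mx i j *t T (block X i j).

Lemma id_tensE (R : realType) (m k l : nat)
    (T : {linear 'M[R[i]]_k -> 'M[R[i]]_l})
    (Y : 'M[R[i]]_m) (Z : 'M[R[i]]_k) :
  id_tens T (Y *t Z) = Y *t T Z.
Proof.
rewrite {2}(matrix_sum_delta Y) /id_tens.
apply/matrixP => s t; rewrite !mxE !summxE mulr_suml.
apply: eq_bigr => i _; rewrite !summxE mulr_suml; apply: eq_bigr => j _.
have -> : block (Y *t Z) i j = Y i j *: Z.
  by apply/matrixP => a b; rewrite !mxE !mxtens_indexK.
by rewrite linearZ !mxE mulrCA mulrA.
Qed.

Definition channel (R : realType) (k l : nat)
    (T : {linear 'M[R[i]]_k -> 'M[R[i]]_l}) : Prop :=
  (forall (m : nat) (X : 'M[R[i]]_(m * k)), psd X -> psd (id_tens T X)) /\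
  (forall X, \tr (T X) = \tr X).

Definition adjoint (R : realType) (k l : nat)
    (T : {linear 'M[R[i]]_k -> 'M[R[i]]_l}) (X : 'M[R[i]]_l) : 'M[R[i]]_k :=
  \matrix_(i, j) \tr (T (delta_mx j i) *m X).

Lemma adjointE (R : realType) (k l : nat)
    (T : {linear 'M[R[i]]_k -> 'M[R[i]]_l})
    (rho : 'M[R[i]]_k) (X : 'M[R[i]]_l) :
  \tr (T rho *m X) = \tr (rho *m adjoint T X).
Proof.
rewrite {1}(matrix_sum_delta rho) linear_sum mulmx_suml linear_sum.
apply: eq_bigr => i _ /=.
rewrite linear_sum mulmx_suml linear_sum mxE.
by apply: eq_bigr => j _; rewrite /= linearZ -scalemxAl linearZ mxE.
Qed.

(** A system is a finite family of registers; register [i] is a qudit of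
    dimension [rdim i]. A computational basis state assigns a digit to each
    register; [enum_val] numbers the basis states. *)

Record system := System {
  reg : finType;
  rdim : reg -> nat;
  rdim_gt0 : forall i, (0 < rdim i)%N }.

Definition basis (S : system) := {dffun forall i : reg S, 'I_(rdim i)}.

Definition hdim (S : system) : nat := #|{: basis S}|.

Lemma hdimE (S : system) : hdim S = (\prod_(i : reg S) rdim i)%N.
Proof.
rewrite /hdim card_dep_ffun foldrE big_map big_enum.
by apply: eq_bigr => i _; rewrite card_ord.
Qed.

Definition label (S : system) (x : 'I_(hdim S)) : basis S := enum_val x.

(* [s] is the restriction of the basis state [w] to the registers selected by
   [f]; digits are compared in nat as [rdim (f i)] and [rdim i] are only
   provably equal. *)
Definition reads (S W : system) (f : reg S -> reg W) (s : basis S)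
    (w : basis W) : bool :=
  [forall i, val (s i) == val (w (f i))].

Record gate (R : realType) := Gate {
  gate_sys : system;
  gate_mx : 'M[R[i]]_(hdim gate_sys);
  gate_unitary : gate_mx \is unitarymx }.

Definition placement (S W : system) (pos : reg S -> reg W) : Prop :=
  injective pos /\ forall i, rdim (pos i) = rdim i.

(* [U] acting on the registers [pos], tensored with the identity elsewhere. *)
Definition place (R : realType) (S W : system) (pos : reg S -> reg W)
    (U : 'M[R[i]]_(hdim S)) : 'M[R[i]]_(hdim W) :=
  \matrix_(x, y)
    if [forall w, (w \notin codom pos) ==> (label x w == label y w)] then
      \sum_u \sum_(v | reads pos (label u) (label x) &&
                       reads pos (label v) (label y)) U u v
    else 0.

Inductive circuit (R : realType) (I : finType) (G : I -> gate R) (W : system) :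
    nat -> 'M[R[i]]_(hdim W) -> Prop :=
| circuit_nil : circuit G 0 1%:M
| circuit_cons (m : nat) (U : 'M[R[i]]_(hdim W)) (g : I)
    (pos : reg (gate_sys (G g)) -> reg W) :
    placement pos -> circuit G m U ->
    circuit G m.+1 (place pos (gate_mx (G g)) *m U).

(* The registers of [W] are split into those of [S] and those of [S']. *)
Definition wiring (S S' W : system) (phi : reg S + reg S' -> reg W) : Prop :=
  [/\ bijective phi,
      forall i, rdim (phi (inl i)) = rdim i &
      forall j, rdim (phi (inr j)) = rdim j].

(* The induced identification of S (x) S' with W. *)
Definition wiring_mx (R : realType) (S S' W : system)
    (phi : reg S + reg S' -> reg W) : 'M[R[i]]_(hdim W, hdim S * hdim S') :=
  \matrix_(w, s)
    (reads (phi \o inl) (label (mxtens_unindex s).1) (label w) &&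
     reads (phi \o inr) (label (mxtens_unindex s).2) (label w))%:R.

Definition ket0 (R : realType) (S : system) : 'cV[R[i]]_(hdim S) :=
  \col_x [forall i, val (label x i) == 0%N]%:R.

(* [T] is realised by a circuit of [m] gates on the registers [W], labelled as
   B, E at the input and as A', K at the output. *)
Definition implementable (R : realType) (I : finType) (G : I -> gate R)
    (B A' : system) (T : {linear 'M[R[i]]_(hdim B) -> 'M[R[i]]_(hdim A')})
    (m : nat) : Prop :=
  exists (E K W : system)
         (phi : reg B + reg E -> reg W) (psi : reg A' + reg K -> reg W)
         (V : 'M[R[i]]_(hdim W)),
    [/\ wiring phi, wiring psi, circuit G m V &
        let U := (wiring_mx R psi) ^t* *m V *m wiring_mx R phi in
        forall rho : 'M[R[i]]_(hdim B),
          T rho =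
          ptrace2 (U *m (rho *t (ket0 R E *m (ket0 R E) ^t*)) *m U ^t*)].

Definition gate_complexity (R : realType) (I : finType) (G : I -> gate R)
    (B A' : system) (T : {linear 'M[R[i]]_(hdim B) -> 'M[R[i]]_(hdim A')}) :
    \bar R :=
  ereal_inf [set (m%:R)%:E | m in implementable G T].

Definition efficient (R : realType) (I : finType) (G : I -> gate R)
    (p : {poly R}) (n : nat) (B A' : system) :
    set {linear 'M[R[i]]_(hdim B) -> 'M[R[i]]_(hdim A')} :=
  [set T | channel T /\ (gate_complexity G T <= (p.[n%:R])%:E)%E].

Arguments efficient {R I} G p n B A' _.

Definition Omega (R : realType) (d : nat) : 'cV[R[i]]_(d * d) :=
  \col_s (((Num.sqrt (d%:R : R))^-1)%:C *
          ((mxtens_unindex s).1 == (mxtens_unindex s).2)%:R).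

Definition choi (R : realType) (d k : nat) (f : 'M[R[i]]_d -> 'M[R[i]]_k) :
    'M[R[i]]_(d * k) :=
  d%:R *: id_tens f (Omega R d *m (Omega R d) ^t*).

Definition Jset (R : realType) (I : finType) (G : I -> gate R) (p : {poly R})
    (n : nat) (A B : system) : set 'M[R[i]]_(hdim A * hdim B) :=
  [set choi (adjoint T) | T in efficient G p n B A].

Arguments Jset {R I} G p n A B _.

Definition convex_cone (R : realType) (m : nat) (K : set 'M[R[i]]_m) : Prop :=
  [/\ K 0,
      (forall X Y, K X -> K Y -> K (X + Y)) &
      (forall (c : R) X, 0 <= c -> K X -> K (c%:C *: X))].

Definition real_subspace (R : realType) (m : nat) (K : set 'M[R[i]]_m) : Prop :=
  [/\ K 0,
      (forall X Y, K X -> K Y -> K (X + Y)) &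
      (forall (c : R) X, K X -> K (c%:C *: X))].

Definition effect_cone (R : realType) (I : finType) (G : I -> gate R)
    (p : {poly R}) (n : nat) (A B : system) : set 'M[R[i]]_(hdim A * hdim B) :=
  smallest (@convex_cone R _) (Jset G p n A B).

Arguments effect_cone {R I} G p n A B _.

Definition informationally_complete (R : realType) (I : finType)
    (G : I -> gate R) (p : {poly R}) (n : nat) (A B : system) : Prop :=
  smallest (@real_subspace R _) (Jset G p n A B) =
  [set X | X \is hermsymmx /\
           exists r : R, ptrace1 X = (r%:C)%:M :> 'M[R[i]]_(hdim B)].

(* The order induced by the dual of the cone [K], used for Hermitian operators
   and a cone of Hermitian operators; the traces are then real, and [<=] on
   [R[i]] restricts to the order of R. *)
Definition le_dual (R : realType) (m : nat) (K : set 'M[R[i]]_m)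
    (X Y : 'M[R[i]]_m) : Prop :=
  forall F, K F -> \tr (X *m F) <= \tr (Y *m F).

Definition cDmax (R : realType) (I : finType) (G : I -> gate R) (p : {poly R})
    (n : nat) (A B : system) (rho sigma : 'M[R[i]]_(hdim A * hdim B)) : \bar R :=
  ereal_inf [set lambda%:E | lambda in
    [set lambda : R |
      le_dual (effect_cone G p n A B) rho ((powR 2 lambda)%:C *: sigma)]].

Definition cHmin (R : realType) (I : finType) (G : I -> gate R) (p : {poly R})
    (n : nat) (A B : system) (rho : 'M[R[i]]_(hdim A * hdim B)) : \bar R :=
  (- ereal_inf [set cDmax G p n rho ((1%:M : 'M[R[i]]_(hdim A)) *t sigma) |
                 sigma in @density R (hdim B)])%E.

Definition fidelity (R : realType) (A B : system)
    (T : {linear 'M[R[i]]_(hdim B) -> 'M[R[i]]_(hdim A)})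
    (rho : 'M[R[i]]_(hdim A * hdim B)) : R :=
  complex.Re (((Omega R (hdim A)) ^t* *m id_tens T rho *m Omega R (hdim A)) 0 0).

(* Base 2, with log 0 = -oo. *)
Definition log2 (R : realType) (x : R) : \bar R :=
  (lne x%:E * ((ln (2 : R))^-1)%:E)%E.

(* Main.v *)
Require Import Defs.
From mathcomp Require Import all_boot all_order all_algebra.
From mathcomp Require Import complex mxtens.
From mathcomp Require Import all_classical all_reals all_analysis.
From mathcomp Require Import sesquilinear ring.

Import Order.TTheory GRing.Theory Num.Theory.
Import ComplexField.
Local Open Scope classical_set_scope.
Local Open Scope ring_scope.

(** Writing J for the Choi operator of T^*, one has Tr[rho J] = d_A F_T(rho), and
    Tr[(1 (x) sigma) J] = Tr[T(sigma)] = 1 for every state sigma.  Hence, for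
    every sigma, rho <=_S 2^lambda (1 (x) sigma) holds iff d_A F_T(rho) <=
    2^lambda for all efficient T, and the infimum over sigma plays no role.
    Since the identity lies in the span of the Choi operators, some F_T(rho) is
    nonzero, so that the logarithm is finite.

    The maximum is attained because, although the ancillas are arbitrary, there
    are finitely many efficient channels: a register that is neither touched by
    a gate nor an input or an output stays in |0> and can be deleted, which
    leaves boundedly many registers of bounded dimension. *)

(** * Choi operators *)

Section Choi.
Local Set Implicit Arguments.
Local Unset Strict Implicit.
Local Open Scope complex_scope.
Local Open Scope sesquilinear_scope.
Context (R : realType).

Lemma sum_mxtens (V : nmodType) (m k : nat) (F : 'I_(m * k) -> V) :
  \sum_s F s = \sum_a \sum_b F (mxtens_index (a, b)).
Proof.
rewrite pair_big /= (reindex (@mxtens_index m k)) /=; last first.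
  by exists (@mxtens_unindex m k) => z _; rewrite ?mxtens_indexK ?mxtens_unindexK.
by apply: eq_bigr => -[a b].
Qed.

Lemma sum_tens_entry (V : nmodType) (d k : nat) (F : 'I_d -> 'I_k -> V) a b :
  (\sum_i \sum_j if (a == i) && (b == j) then F i j else 0) = F a b.
Proof.
rewrite (bigD1 a) //= [X in _ + X]big1 ?addr0 => [|i /negPf ia].
  rewrite (bigD1 b) //= !eqxx big1 ?addr0 // => j /negPf jb.
  by rewrite eq_sym jb.
by apply: big1 => j _; rewrite eq_sym ia.
Qed.

Lemma id_tens_entry (m k l : nat) (f : 'M[R[i]]_k -> 'M[R[i]]_l) X a b x y :
  @id_tens R m k l f X (mxtens_index (a, x)) (mxtens_index (b, y))
  = f (block X a b) x y.
Proof.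
rewrite /id_tens summxE -[RHS](@sum_tens_entry _ m m
  (fun i j => f (block X i j) x y)).
apply: eq_bigr => i _; rewrite summxE; apply: eq_bigr => j _.
rewrite tensmxE mxE.
by case: ifP => _; rewrite ?mul1r ?mul0r.
Qed.

(** The two square roots combine to 1/d here, so later computations with Omega contain no roots. *)
Lemma Omega_sqr (d : nat) s t :
  Omega R d s 0 * (Omega R d t 0)^*%R =
  ((mxtens_unindex s).1 == (mxtens_unindex s).2)%:R *
  ((mxtens_unindex t).1 == (mxtens_unindex t).2)%:R / d%:R.
Proof.
have conj_real (x : R) : (x%:C)^*%R = x%:C := conjc_real x.
rewrite !mxE rmorphM /= conj_real conjC_nat.
rewrite mulrACA mulrC; congr (_ * _).
rewrite -rmorphM -invfM -expr2 sqr_sqrtr ?ler0n //.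
by rewrite fmorphV /= rmorph_nat.
Qed.

Lemma adjointZ (k l : nat) (T : {linear 'M[R[i]]_k -> 'M[R[i]]_l}) c X :
  adjoint T (c *: X) = c *: adjoint T X.
Proof. by apply/matrixP => a b; rewrite !mxE -scalemxAr linearZ. Qed.

(** The prefactor d of [choi] cancels the 1/d in the projector on Omega, so block (a, b) of the Choi
    operator is T^* of the matrix unit |a><b|. *)
Lemma choi_entry (d k : nat) (T : {linear 'M[R[i]]_k -> 'M[R[i]]_d}) a b x y :
  (0 < d)%N ->
  choi (adjoint T) (mxtens_index (a, x)) (mxtens_index (b, y)) =
  T (delta_mx y x) b a.
Proof.
move=> d0; rewrite /choi mxE id_tens_entry.
have -> : block (Omega R d *m (Omega R d) ^t*) a b = d%:R^-1 *: delta_mx a b.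
  apply/matrixP => s t; rewrite !mxE big_ord1.
  rewrite [(_ ^t*) _ _]mxE [(_ ^T) _ _]mxE Omega_sqr !mxtens_indexK /=.
  by rewrite mulrC -natrM mulnb (eq_sym a) (eq_sym b).
rewrite adjointZ mxE mulrA divff ?pnatr_eq0 -?lt0n // mul1r mxE.
rewrite /mxtrace (bigD1 b) //= [X in _ + X]big1 => [|i /negPf ib].
  rewrite addr0 mxE (bigD1 a) //= big1 ?addr0 => [|j /negPf ja].
    by rewrite mxE !eqxx mulr1.
  by rewrite mxE ja mulr0.
by rewrite mxE big1 // => j _; rewrite mxE ib andbF mulr0.
Qed.

(** Expanding each block of [rho] in matrix units and using linearity of T gives a form free of
    adjoints, from which both evaluations below follow. *)
Lemma tr_choi (d k : nat) (T : {linear 'M[R[i]]_k -> 'M[R[i]]_d})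
    (rho : 'M[R[i]]_(d * k)) : (0 < d)%N ->
  \tr (rho *m choi (adjoint T)) = \sum_a \sum_b T (block rho a b) a b.
Proof.
move=> d0; rewrite /mxtrace sum_mxtens; apply: eq_bigr => a _.
under eq_bigr => x _.
  rewrite mxE sum_mxtens.
  under eq_bigr => b _ do under eq_bigr => y _ do rewrite choi_entry //.
  over.
rewrite exchange_big /=; apply: eq_bigr => b _.
rewrite [in RHS](matrix_sum_delta (block rho a b)) linear_sum summxE.
apply: eq_bigr => x _; rewrite linear_sum summxE.
by apply: eq_bigr => y _; rewrite linearZ !mxE.
Qed.

Lemma tr_choi_Omega (d k : nat) (T : {linear 'M[R[i]]_k -> 'M[R[i]]_d})
    (rho : 'M[R[i]]_(d * k)) : (0 < d)%N ->
  \tr (rho *m choi (adjoint T)) =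
  d%:R * ((Omega R d) ^t* *m id_tens T rho *m Omega R d) 0 0.
Proof.
move=> d0; rewrite tr_choi //.
have dn0 : d%:R != 0 :> R[i] by rewrite pnatr_eq0 -lt0n.
(* Contraction with Omega collapses a sum over pairs to the diagonal; it is applied once for the bra
   and once for the ket. *)
have diag (F : 'I_(d * d) -> R[i]) :
    \sum_s F s * ((mxtens_unindex s).1 == (mxtens_unindex s).2)%:R =
    \sum_a F (mxtens_index (a, a)).
  rewrite sum_mxtens; apply: eq_bigr => a _.
  rewrite (bigD1 a) // mxtens_indexK eqxx mulr1 big1 ?Monoid.mulm1 // => b /negPf ab.
  by rewrite mxtens_indexK /= eq_sym ab mulr0.
rewrite mxE.
under [in RHS]eq_bigr => t _.
  rewrite mxE mulr_suml.
  under eq_bigr => s _ do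
    rewrite mulrAC [(_ ^t*) _ _]mxE [(_ ^T) _ _]mxE [_^* * _]mulrC Omega_sqr
      [X in X / _]mulrC -!mulrA mulrC -!mulrA.
  rewrite -!mulr_sumr diag mulrC.
  over.
rewrite diag mulr_sumr exchange_big; apply: eq_bigr => b _.
rewrite mulrA divff // mul1r; apply: eq_bigr => a _.
by rewrite id_tens_entry.
Qed.

(** The diagonal blocks of 1 (x) sigma are sigma and the others vanish. *)
Lemma tr_choi_unital (d k : nat) (T : {linear 'M[R[i]]_k -> 'M[R[i]]_d}) sigma :
  (0 < d)%N -> \tr ((1%:M : 'M[R[i]]_d) *t sigma *m choi (adjoint T)) = \tr (T sigma).
Proof.
move=> d0; rewrite tr_choi //; apply: eq_bigr => a _.
rewrite (bigD1 a) //= big1 ?addr0 => [|b /negPf ab].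
  congr (T _ a a); apply/matrixP => x y.
  by rewrite !mxE !mxtens_indexK /= eqxx mul1r.
rewrite (_ : block _ a b = 0) ?linear0 ?mxE //; apply/matrixP => x y.
by rewrite !mxE !mxtens_indexK /= eq_sym ab mul0r.
Qed.
End Choi.

(** * Weak and strong duality *)

Section Duality.
Local Set Implicit Arguments.
Local Unset Strict Implicit.
Local Open Scope complex_scope.
Local Open Scope sesquilinear_scope.
Context (R : realType) (I : finType) (G : I -> gate R) (p : {poly R}) (n : nat)
  (A B : system).

Lemma hdim_gt0 (S : system) : (0 < hdim S)%N.
Proof. by rewrite hdimE prodn_gt0 // => i; exact: rdim_gt0. Qed.

Lemma fidelity_form_ge0 (T : {linear 'M[R[i]]_(hdim B) -> 'M[R[i]]_(hdim A)})
    rho : channel T -> psd rho ->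
  0 <= ((Omega R (hdim A)) ^t* *m id_tens T rho *m Omega R (hdim A)) 0 0.
Proof. by move=> [Tcp _] rho0; exact: Tcp. Qed.

Lemma fidelity_ge0 (T : {linear 'M[R[i]]_(hdim B) -> 'M[R[i]]_(hdim A)}) rho :
  channel T -> psd rho -> 0 <= fidelity T rho.
Proof.
by move=> cT rho0; have := fidelity_form_ge0 cT rho0; rewrite lecE => /andP[].
Qed.

(** Nonnegativity in [R[i]] includes a zero imaginary part, so the real part taken in [fidelity]
    loses nothing. *)
Lemma tr_choi_fidelity (T : {linear 'M[R[i]]_(hdim B) -> 'M[R[i]]_(hdim A)}) rho :
  channel T -> psd rho ->
  \tr (rho *m choi (adjoint T)) = ((hdim A)%:R * fidelity T rho)%:C.
Proof.
move=> cT rho0; rewrite tr_choi_Omega ?hdim_gt0 //.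
rewrite rmorphM rmorph_nat /= RRe_real // ger0_real //.
exact: fidelity_form_ge0.
Qed.

Lemma tr_choi_channel (T : {linear 'M[R[i]]_(hdim B) -> 'M[R[i]]_(hdim A)}) sigma :
  channel T -> density sigma ->
  \tr ((1%:M : 'M[R[i]]_(hdim A)) *t sigma *m choi (adjoint T)) = 1.
Proof. by move=> [_ Ttr] [_ s1]; rewrite tr_choi_unital ?hdim_gt0 // Ttr. Qed.

Lemma density_exists (k : nat) : (0 < k)%N -> exists X : 'M[R[i]]_k, density X.
Proof.
case: k => // k _; exists (delta_mx 0 0); split=> [v|].
  rewrite -(mul_delta_mx (0 : 'I_1)) mulmxA -mulmxA mxE big_ord1.
  by rewrite -colE -rowE !mxE mulrC mul_conjC_ge0.
rewrite /mxtrace (bigD1 0) //= big1 ?addr0 ?mxE // => i /negPf i0.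
by rewrite mxE i0.
Qed.

(** The operators F that satisfy the inequality form a convex cone, so it suffices to test the
    generators. *)
Lemma le_dual_effect_cone (X Y : 'M[R[i]]_(hdim A * hdim B)) :
  (forall T, efficient G p n B A T ->
    \tr (X *m choi (adjoint T)) <= \tr (Y *m choi (adjoint T))) ->
  le_dual (effect_cone G p n A B) X Y.
Proof.
move=> le F; rewrite -/(([set F | \tr (X *m F) <= \tr (Y *m F)]) F).
apply: smallest_sub => [|_ [T effT <-]]; last exact: le.
split=> /= [|F1 F2 h1 h2|c F1 c0 h1].
- by rewrite !mulmx0.
- by rewrite !mulmxDr !mxtraceD lerD.
- by rewrite -!scalemxAr !mxtraceZ ler_wpM2l // lecR.
Qed.

Lemma choi_separates (rho : 'M[R[i]]_(hdim A * hdim B)) :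
  informationally_complete G p n A B -> \tr rho != 0 ->
  exists2 T, efficient G p n B A T & \tr (rho *m choi (adjoint T)) != 0.
Proof.
move=> hIC rho0; apply: contrapT => noT; move/negP: rho0; apply; apply/eqP.
(* The identity is Hermitian and its partial trace over A is d_A times the identity of B. *)
have : smallest (@real_subspace R _) (Jset G p n A B) 1%:M.
  rewrite hIC; split.
    apply/is_hermitianmxP; rewrite expr0 scale1r.
    by rewrite trmx1 map_mx1.
  exists (hdim A)%:R; apply/matrixP => a b.
  rewrite !mxE summxE; under eq_bigr do rewrite !mxE.
  have eqi (i : 'I_(hdim A)) :
      (mxtens_index (i, a) == mxtens_index (i, b)) = (a == b).
    by rewrite (can_eq (@mxtens_indexK _ _)) xpair_eqE eqxx.
  under eq_bigr do rewrite eqi.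
  by rewrite sumr_const card_ord rmorph_nat -!mulrnA mulnC.
(* The operators F with Tr[rho F] = 0 form a real subspace; if it contained every Choi operator it
   would contain the identity, and Tr[rho] would vanish. *)
have sub : [set F | \tr (rho *m F) = 0] 1%:M -> \tr rho = 0 by rewrite /= mulmx1.
move=> h; apply: sub; move: h; apply: smallest_sub.
  split=> /= [|F1 F2 h1 h2|c F1 h1].
  - by rewrite mulmx0 mxtrace0.
  - by rewrite mulmxDr mxtraceD h1 h2 addr0.
  - by rewrite -scalemxAr mxtraceZ h1 mulr0.
move=> _ [T effT <-] /=; apply/eqP; apply: contrapT => /negP ne.
by apply: noT; exists T.
Qed.

Lemma cHmin_max_fidelity rho (M : R) :
  density rho -> 0 < M ->
  [set fidelity T rho | T in efficient G p n B A] M ->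
  ubound [set fidelity T rho | T in efficient G p n B A] M ->
  cHmin G p n rho = (- log2 ((hdim A)%:R * M))%E.
Proof.
move=> [rho0 _] M0 [T0 effT0 MT0] Mub; congr (- _)%E.
have dM0 : 0 < (hdim A)%:R * M by rewrite mulr_gt0 // ltr0n hdim_gt0.
have ln20 : 0 < ln (2 : R) by rewrite ln_gt0 // ltr1n.
rewrite /log2 lne_EFin // -EFinM.
set L := _ / _.
have powL : powR 2 L = (hdim A)%:R * M.
  apply: (@ln_inj R); rewrite ?posrE ?powR_gt0 //.
  by rewrite ln_powR divfK // gt_eqF.
apply/eqP; rewrite eq_le; apply/andP; split; last first.
  (* Lower bound: for every sigma, a feasible exponent is tested against the Choi operator of the
     optimal [T0]. *)
  apply: le_ereal_inf_tmp => _ [sigma sd <-]; apply: le_ereal_inf_tmp => _ [l hl <-].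
  have /hl : effect_cone G p n A B (choi (adjoint T0)).
    by apply: sub_gen_smallest; exists T0.
  rewrite -scalemxAl mxtraceZ tr_choi_channel ?mulr1 //; last by case: effT0.
  rewrite tr_choi_fidelity //; last by case: effT0.
  rewrite MT0 lecR -powL lee_fin => h.
  by move: h; rewrite -ler_ln ?posrE ?powR_gt0 // !ln_powR ler_pM2r.
(* Upper bound: the exponent [L] is feasible for an arbitrary state, so any one will do. *)
have [sigma sd] := density_exists (hdim_gt0 B).
apply: (@le_trans _ _ (cDmax G p n rho ((1%:M : 'M[R[i]]_(hdim A)) *t sigma))).
  by apply: ereal_inf_lbound; exists sigma.
apply: ereal_inf_lbound; exists L => //=.
apply: le_dual_effect_cone => T effT.
rewrite -scalemxAl mxtraceZ tr_choi_channel ?mulr1 //; last by case: effT.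
rewrite tr_choi_fidelity //; last by case: effT.
by rewrite lecR powL ler_wpM2l ?ler0n // Mub //; exists T.
Qed.
End Duality.

(** * Deleting idle registers *)

Section ZeroExtension.
Local Set Implicit Arguments.
Local Unset Strict Implicit.
Local Open Scope complex_scope.
Local Open Scope sesquilinear_scope.
Context (R : realType).
(* The analysis library exports a topological [basis]. *)
Local Notation basis := Defs.basis.

Definition basis0 (S : system) : basis S :=
  [ffun i => Ordinal (rdim_gt0 i)].

(** This is the condition that [place] imposes on the registers its gate does not touch. *)
Definition eq_off (S W : system) (f : reg S -> reg W) (x y : basis W) : bool :=
  [forall w, (w \notin codom f) ==> (x w == y w)].

(* The isometry that appends |0> on the registers of [W] outside the range of
   [f]. *)
Definition zero_ext (S W : system) (f : reg S -> reg W) :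
    'M[R[i]]_(hdim W, hdim S) :=
  \matrix_(x, u) (reads f (label u) (label x) && eq_off f (label x) (basis0 W))%:R.

Lemma label_inj (S : system) : injective (@label S).
Proof. exact: enum_val_inj. Qed.

Lemma label_surj (S : system) (x : basis S) : exists u, label u = x.
Proof. by exists (enum_rank x); rewrite /label enum_rankK. Qed.

Lemma basis_eqP (S : system) (x y : basis S) :
  (forall i, val (x i) = val (y i)) <-> x = y.
Proof.
by split=> [xy|-> //]; apply/ffunP => i; apply: val_inj; exact: xy.
Qed.

Lemma reads_inj (S W : system) (f : reg S -> reg W) s t w :
  reads f s w -> reads f t w -> s = t.
Proof.
move=> /forallP sw /forallP tw; apply/basis_eqP => i.
by rewrite (eqP (sw i)) (eqP (tw i)).
Qed.

Lemma reads_ex (S W : system) (f : reg S -> reg W) (w : basis W) :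
  (forall i, rdim (f i) = rdim i) -> exists s, reads f s w.
Proof.
move=> dimf; exists [ffun i => cast_ord (dimf i) (w (f i))].
by apply/forallP => i; rewrite ffunE.
Qed.

(** The digit of each register is chosen separately; by injectivity of [f] at most one register of S
    prescribes it. *)
Lemma ex_reads_eq_off (S W : system) (f : reg S -> reg W) (s : basis S)
    (w0 : basis W) : placement f ->
  exists w, reads f s w && eq_off f w w0.
Proof.
move=> [injf dimf].
pose P w (d : 'I_(rdim w)) :=
  (forall i, f i = w -> val d = val (s i)) /\ (w \notin codom f -> d = w0 w).
have /fin_all_exists[u uP] : forall w, exists d, P w d.
  move=> w; have [/codomP[i ->]|wf] := boolP (w \in codom f).
    exists (cast_ord (esym (dimf i)) (s i)); split=> [i' /injf -> //|].
    by rewrite codom_f.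
  by exists (w0 w); split=> // i iw; rewrite -iw codom_f in wf.
exists [ffun w => u w]; apply/andP; split; apply/forallP => i.
  by rewrite ffunE eq_sym; apply/eqP/(uP (f i)).1.
by apply/implyP => ?; rewrite ffunE; apply/eqP/(uP i).2.
Qed.

(** Since [zero_ext] is the 0/1 matrix of an injection [e] of basis indices, sums in products with
    it reduce to one term. *)
Lemma zero_ext_fun (S W : system) (f : reg S -> reg W) : placement f ->
  exists e : 'I_(hdim S) -> 'I_(hdim W),
    [/\ forall u, reads f (label u) (label (e u)),
        forall u, eq_off f (label (e u)) (basis0 W),
        injective e &
        forall x u, zero_ext f x u = (x == e u)%:R].
Proof.
move=> pf.
have /fin_all_exists[e eP] : forall u : 'I_(hdim S), exists x : 'I_(hdim W),
    reads f (label u) (label x) && eq_off f (label x) (basis0 W).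
  move=> u; have [w] := ex_reads_eq_off (label u) (basis0 W) pf.
  by have [x <-] := label_surj w; exists x.
have e1 u : reads f (label u) (label (e u)) by have /andP[] := eP u.
have e2 u : eq_off f (label (e u)) (basis0 W) by have /andP[] := eP u.
exists e; split=> // [u v uv|x u].
  by apply: label_inj; apply: reads_inj (e1 u) _; rewrite uv.
rewrite mxE; congr (_%:R); congr nat_of_bool; apply/idP/eqP => [/andP[r o]|->//].
apply: label_inj; apply/ffunP => w.
have [/codomP[i ->]|wf] := boolP (w \in codom f).
  apply: val_inj; move/forallP/(_ i)/eqP: r => <-.
  by move/forallP/(_ i)/eqP: (e1 u).
move/forallP/(_ w): o; rewrite wf => /eqP ->.
by move/forallP/(_ w): (e2 u); rewrite wf => /eqP ->.
Qed.

Lemma reads_comp (S' S W : system) (f : reg S' -> reg S) (j : reg S -> reg W)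
    s t w :
  reads j s w -> reads (j \o f) t w = reads f t s.
Proof.
move=> /forallP r; apply: eq_forallb => i /=.
by rewrite (eqP (r (f i))).
Qed.

(** A register outside the range of [j \o f] is either outside the range of [j], where x and y agree
    by assumption, or the image of one outside the range of [f]. *)
Lemma eq_off_comp (S' S W : system) (f : reg S' -> reg S) (j : reg S -> reg W)
    s t x y : injective j ->
  reads j s x -> reads j t y -> eq_off j x y ->
  eq_off (j \o f) x y = eq_off f s t.
Proof.
move=> injj /forallP rs /forallP rt /forallP o.
apply/forallP/forallP => h.
  move=> i; apply/implyP => fi.
  have : j i \notin codom (j \o f).
    by apply: contra fi => /codomP[k /injj ->]; exact: codom_f.
  move: (h (j i)) => /implyP/[apply] /eqP xy.
  by rewrite -val_eqE /= (eqP (rs i)) (eqP (rt i)) xy.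
move=> w; apply/implyP => wjf.
have [/codomP[i wi]|wj] := boolP (w \in codom j); last exact: (implyP (o w)).
rewrite wi -val_eqE -(eqP (rs i)) -(eqP (rt i)) val_eqE; apply: (implyP (h i)).
by apply: contra wjf => /codomP[k ik]; rewrite wi ik; exact: codom_f.
Qed.

Lemma eq_off_compW (S' S W : system) (f : reg S' -> reg S) (j : reg S -> reg W)
    x y : eq_off (j \o f) x y -> eq_off j x y.
Proof.
move=> /forallP o; apply/forallP => w; apply/implyP => wj.
by apply: (implyP (o w)); apply: contra wj => /codomP[k ->]; exact: codom_f.
Qed.

Lemma eq_off_trans (S W : system) (f : reg S -> reg W) x y z :
  eq_off f x y -> eq_off f y z -> eq_off f x z.
Proof.
move=> /forallP xy /forallP yz; apply/forallP => w; apply/implyP => wf.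
by rewrite (eqP (implyP (xy w) wf)); exact: (implyP (yz w) wf).
Qed.

Lemma eq_off_sym (S W : system) (f : reg S -> reg W) x y :
  eq_off f x y = eq_off f y x.
Proof. by apply: eq_forallb => w; rewrite eq_sym. Qed.

Lemma reads_basis0 (S W : system) (f : reg S -> reg W) :
  reads f (basis0 S) (basis0 W).
Proof. by apply/forallP => i; rewrite !ffunE. Qed.

Lemma zero_ext_image (S W : system) (f : reg S -> reg W) x : placement f ->
  eq_off f (label x) (basis0 W) -> exists u, zero_ext f x u = 1.
Proof.
move=> [_ dimf] o; have [s r] := reads_ex (label x) dimf.
by have [u us] := label_surj s; exists u; rewrite mxE us r o.
Qed.

(** Entrywise criterion for factoring through the isometry: the rows of X outside its image vanish,
    and the others are rows of Y. *)
Lemma zero_ext_intertwine (S W : system) (j : reg S -> reg W) (k : nat)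
    (X : 'M[R[i]]_(hdim W, k)) (Y : 'M[R[i]]_(hdim S, k)) : placement j ->
  (forall x s, X x s != 0 -> eq_off j (label x) (basis0 W)) ->
  (forall x u s, zero_ext j x u = 1 -> X x s = Y u s) ->
  X = zero_ext j *m Y.
Proof.
move=> pj X0 XY; have [e [_ _ e_inj eE]] := zero_ext_fun pj.
apply/matrixP => x s; rewrite mxE.
have [[u xu]|no] := pselect (exists u, x = e u).
  rewrite (bigD1 u) //= eE xu eqxx mul1r big1 ?addr0 => [|v /negPf vu].
    by rewrite (XY _ u) // eE eqxx.
  by rewrite eE (inj_eq e_inj) eq_sym vu mul0r.
rewrite big1 => [|v _]; last first.
  by rewrite eE (_ : x == e v = false) ?mul0r //; apply/eqP => xv; apply: no; exists v.
apply: contrapT => /eqP/X0/(zero_ext_image pj)[u].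
rewrite eE; case: (x =P e u) => [xu _|_ /eqP]; first by apply: no; exists u.
by rewrite eq_sym oner_eq0.
Qed.

Lemma zero_ext_comp (S' S W : system) (f : reg S' -> reg S)
    (j : reg S -> reg W) : placement j ->
  zero_ext (j \o f) = zero_ext j *m zero_ext f.
Proof.
move=> pj; have [e [e1 e2 e_inj eE]] := zero_ext_fun pj.
apply: zero_ext_intertwine => // [x s|x u s].
  rewrite mxE; case: andP => [[_ /eq_off_compW] //|_]; by rewrite eqxx.
rewrite eE; case: (x =P e u) => [->|_ /eqP]; last by rewrite eq_sym oner_eq0.
move=> _; rewrite !mxE (reads_comp _ _ (e1 u)).
by rewrite (eq_off_comp _ pj.1 (e1 u) (reads_basis0 j)).
Qed.

(** A gate placed inside S leaves the appended zeros alone; this is what allows idle registers to be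
    deleted from a circuit. *)
Lemma place_zero_ext (Q S W : system) (f : reg Q -> reg S) (j : reg S -> reg W)
    (U : 'M[R[i]]_(hdim Q)) : placement j ->
  place (j \o f) U *m zero_ext j = zero_ext j *m place f U.
Proof.
move=> pj; have [e [e1 e2 e_inj eE]] := zero_ext_fun pj.
have col x u : (place (j \o f) U *m zero_ext j) x u = place (j \o f) U x (e u).
  rewrite mxE (bigD1 (e u)) //= eE eqxx mulr1 big1 ?addr0 // => y /negPf yu.
  by rewrite eE yu mulr0.
apply: zero_ext_intertwine => // [x u|x v u].
  rewrite col mxE -/(eq_off (j \o f) _ _); case: ifP => [hx _|]; last by rewrite eqxx.
  exact: eq_off_trans (eq_off_compW hx) (e2 u).
rewrite eE; case: (x =P e v) => [->|_ /eqP]; last by rewrite eq_sym oner_eq0.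
move=> _; rewrite col !mxE -/(eq_off (j \o f) _ _) -/(eq_off f _ _).
rewrite (eq_off_comp _ pj.1 (e1 v) (e1 u)); last first.
  by apply: eq_off_trans (e2 v) _; rewrite eq_off_sym.
case: ifP => // _; apply: eq_bigr => a _; apply: eq_bigl => b.
by rewrite (reads_comp _ _ (e1 v)) (reads_comp _ _ (e1 u)).
Qed.

(** The operator |a'><a| on the registers [psi], tensored with the identity elsewhere; its trace
    against X is an entry of the reduced operator. *)
Definition readout_mx (A W : system) (psi : reg A -> reg W) (a a' : 'I_(hdim A)) :
    'M[R[i]]_(hdim W) :=
  \matrix_(y, x) [&& reads psi (label a) (label x), reads psi (label a') (label y)
                   & eq_off psi (label x) (label y)]%:R.

(* The partial trace over the registers outside the range of [psi]. *)
Definition readout (A W : system) (psi : reg A -> reg W) (X : 'M[R[i]]_(hdim W)) :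
    'M[R[i]]_(hdim A) :=
  \matrix_(a, a') \tr (readout_mx psi a a' *m X).

(** By cyclicity of the trace the isometry acts on [readout_mx] instead, and compressing that
    operator to S gives its counterpart on S. *)
Lemma readout_zero_ext (A S W : system) (psi : reg A -> reg S)
    (j : reg S -> reg W) (X : 'M[R[i]]_(hdim S)) : placement j ->
  readout (j \o psi) (zero_ext j *m X *m (zero_ext j)^t*) = readout psi X.
Proof.
move=> pj; have [e [e1 e2 e_inj eE]] := zero_ext_fun pj.
apply/matrixP => a a'; rewrite !mxE mulmxA mxtrace_mulC !mulmxA.
congr (\tr (_ *m _)); apply/matrixP => v u; rewrite mxE.
rewrite (bigD1 (e u)) //= big1 ?addr0 => [|y /negPf yu]; last first.
  by rewrite eE yu mulr0.
rewrite eE eqxx mulr1 mxE (bigD1 (e v)) //= big1 ?addr0 => [|y /negPf yv]; last first.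
  by rewrite [(_ ^t*) _ _]mxE [(_ ^T) _ _]mxE eE yv conjC0 mul0r.
rewrite [(_ ^t*) _ _]mxE [(_ ^T) _ _]mxE eE eqxx conjC1 mul1r !mxE.
rewrite (reads_comp _ _ (e1 v)) (reads_comp _ _ (e1 u)).
rewrite (eq_off_comp _ pj.1 (e1 u) (e1 v)) //.
by apply: eq_off_trans (e2 u) _; rewrite eq_off_sym.
Qed.

(** A form of the circuit channel that does not name E and K: they are the complements of the ranges
    of [phi] and [psi]. *)
Definition run (A B W : system) (phi : reg B -> reg W) (psi : reg A -> reg W)
    (V : 'M[R[i]]_(hdim W)) (rho : 'M[R[i]]_(hdim B)) : 'M[R[i]]_(hdim A) :=
  readout psi (V *m zero_ext phi *m rho *m (V *m zero_ext phi)^t*).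

Lemma run_zero_ext (A B S W : system) (phi : reg B -> reg S)
    (psi : reg A -> reg S) (j : reg S -> reg W) (V : 'M[R[i]]_(hdim W)) V' :
  placement j -> V *m zero_ext j = zero_ext j *m V' ->
  run (j \o phi) (j \o psi) V =1 run phi psi V'.
Proof.
move=> pj VV' rho; rewrite /run zero_ext_comp // mulmxA VV'.
rewrite -(mulmxA (zero_ext j)) -(readout_zero_ext _ _ pj).
by congr readout; rewrite trmx_mul map_mxM !mulmxA.
Qed.

End ZeroExtension.

(** * Eliminating the ancillas E and K *)

Section Wiring.
Local Set Implicit Arguments.
Local Unset Strict Implicit.
Local Open Scope complex_scope.
Local Open Scope sesquilinear_scope.
Context (R : realType).

Lemma wiring_placement (S S' W : system) (phi : reg S + reg S' -> reg W) :
  wiring phi -> placement (phi \o inl) /\ placement (phi \o inr).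
Proof.
move=> [/bij_inj injphi dl dr]; split; split=> //.
  by move=> i i' /injphi [].
by move=> i i' /injphi [].
Qed.

Lemma reads_wiringr (S S' W : system) (phi : reg S + reg S' -> reg W) k x y :
  wiring phi -> reads (phi \o inr) k y ->
  reads (phi \o inr) k x = eq_off (phi \o inl) x y.
Proof.
move=> [bphi _ _] /forallP ky; apply/forallP/forallP => h.
  move=> w; apply/implyP => wl; have [g _ gK] := bphi.
  case gw : (g w) => [i|i].
    by move/negP: wl; case; apply/codomP; exists i; rewrite /= -gw gK.
  rewrite -(gK w) gw -val_eqE /=; move: (h i) (ky i) => /= /eqP <- /eqP ->.
  exact: eqxx.
move=> i; rewrite (eqP (ky i)) /= eq_sym val_eqE; apply: (implyP (h _)).
by apply/negP => /codomP[i' /(bij_inj bphi)].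
Qed.

(** The projector on |0> keeps only the index [e0] of E, and reading zeros on E is the same as being
    zero off the registers of B. *)
Lemma wiring_mx_ket0 (B E W : system) (phi : reg B + reg E -> reg W)
    (rho : 'M[R[i]]_(hdim B)) : wiring phi ->
  wiring_mx R phi *m (rho *t (ket0 R E *m (ket0 R E)^t*)) *m (wiring_mx R phi)^t*
  = zero_ext R (phi \o inl) *m rho *m (zero_ext R (phi \o inl))^t*.
Proof.
move=> wphi.
have [e0 e0E] := label_surj (basis0 E).
have ketE e : ket0 R E e 0 = (e == e0)%:R.
  rewrite mxE; congr (_%:R); congr nat_of_bool; apply/forallP/eqP => [h|-> i].
    apply: label_inj; rewrite e0E; apply/basis_eqP => i; rewrite (eqP (h i)).
    by rewrite ffunE.
  by rewrite e0E ffunE.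
have colE b w : wiring_mx R phi w (mxtens_index (b, e0)) =
    zero_ext R (phi \o inl) w b.
  rewrite !mxE mxtens_indexK /= e0E.
  by rewrite (reads_wiringr _ wphi (reads_basis0 _)).
have sum0 (F : 'I_(hdim E) -> R[i]) : \sum_e F e * (e == e0)%:R = F e0.
  rewrite (bigD1 e0) //= eqxx mulr1 big1 ?addr0 // => e /negPf ->.
  by rewrite mulr0.
have prodE x b' e' : (wiring_mx R phi *m (rho *t (ket0 R E *m (ket0 R E)^t*))) x
    (mxtens_index (b', e')) = (zero_ext R (phi \o inl) *m rho) x b' * (e' == e0)%:R.
  rewrite mxE sum_mxtens [in RHS]mxE mulr_suml; apply: eq_bigr => b _.
  rewrite -colE -(sum0 (fun e => wiring_mx R phi x (mxtens_index (b, e)) *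
    rho b b' * (e' == e0)%:R)); apply: eq_bigr => e _.
  rewrite tensmxE [(ket0 R E *m _) _ _]mxE big_ord1 [(_ ^t*) _ _]mxE.
  by rewrite [(_ ^T) _ _]mxE !ketE conjC_nat; ring.
apply/matrixP => x y; rewrite mxE [RHS]mxE sum_mxtens; apply: eq_bigr => b' _.
under eq_bigr => e' _ do rewrite prodE mulrAC.
rewrite sum0; congr (_ * _).
by rewrite [LHS]mxE [RHS]mxE; congr (_^*); rewrite [LHS]mxE [RHS]mxE colE.
Qed.

Lemma ptrace2_wiring_mx (A K W : system) (psi : reg A + reg K -> reg W)
    (Y : 'M[R[i]]_(hdim W)) : wiring psi ->
  ptrace2 ((wiring_mx R psi)^t* *m Y *m wiring_mx R psi) =
  readout (psi \o inl) Y.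
Proof.
move=> wpsi; apply/matrixP => a a'; rewrite !mxE.
(* Resolution of the identity on K: |a'><a| (x) 1 is the sum over k of |a',k><a,k|. *)
have CE : readout_mx R (psi \o inl) a a' =
    \sum_k col (mxtens_index (a', k)) (wiring_mx R psi) *m
           (col (mxtens_index (a, k)) (wiring_mx R psi))^t*.
  apply/matrixP => y x; rewrite summxE mxE.
  (* The digits of [x] on K single out the one term that can be nonzero. *)
  have [|k0] := @reads_ex _ _ (psi \o inr) (label x).
    by have [_ []] := wiring_placement wpsi.
  have [k <-] := label_surj k0 => xk.
  rewrite (bigD1 k) //= big1 ?addr0 => [|k' /negPf k'k].
    rewrite !mxE big_ord1 !mxE !mxtens_indexK /= conjC_nat -natrM mulnb xk andbT.
    rewrite (reads_wiringr _ wpsi xk) eq_off_sym.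
    by rewrite andbC -andbA [X in _ && X]andbC.
  rewrite !mxE big_ord1 !mxE !mxtens_indexK /= conjC_nat -natrM mulnb.
  case xk' : (reads (psi \o inr) (label k') (label x)).
    by move/eqP: k'k; case; exact/label_inj/(reads_inj xk' xk).
  by rewrite !andbF.
rewrite CE mulmx_suml raddf_sum /=; apply: eq_bigr => k _.
rewrite -[in RHS]mulmxA [RHS]mxtrace_mulC /mxtrace big_ord1.
rewrite !mxE; apply: eq_bigr => x _; rewrite [in RHS]mxE; congr (_ * _); last by rewrite !mxE.
by rewrite !mxE; apply: eq_bigr => y _; rewrite !mxE.
Qed.

Lemma implementable_run (I : finType) (G : I -> gate R) (B A : system)
    (T : {linear 'M[R[i]]_(hdim B) -> 'M[R[i]]_(hdim A)}) m :
  implementable G T m ->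
  exists (W : system) (phi : reg B -> reg W) (psi : reg A -> reg W) V,
    [/\ placement phi, placement psi, circuit G m V & T =1 run phi psi V].
Proof.
move=> [E [K [W [phi [psi [V [wphi wpsi GV TE]]]]]]].
exists W, (phi \o inl), (psi \o inl), V; split=> //.
- by have [] := wiring_placement wphi.
- by have [] := wiring_placement wpsi.
move=> rho; rewrite TE /run -(ptrace2_wiring_mx _ wpsi); congr ptrace2.
rewrite !trmx_mul !map_mxM /=.
have -> : ((wiring_mx R psi)^t*)^t* = wiring_mx R psi.
  by apply/matrixP => a b; rewrite !mxE conjCK.
transitivity ((wiring_mx R psi)^t* *m (V *m (wiring_mx R phi *m
    (rho *t (ket0 R E *m (ket0 R E)^t*)) *m (wiring_mx R phi)^t*) *m V^t*) *m
  wiring_mx R psi); first by rewrite !mulmxA.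
by rewrite (wiring_mx_ket0 _ wphi) !mulmxA.
Qed.
End Wiring.

(** * Finitely many efficient channels *)

Section Finiteness.
Local Set Implicit Arguments.
Local Unset Strict Implicit.
Context (R : realType) (I : finType) (G : I -> gate R).

Lemma placement_factor (Q S W : system) (f : reg Q -> reg W) (j : reg S -> reg W) :
  placement f -> placement j -> (forall q, f q \in codom j) ->
  exists2 g : reg Q -> reg S, placement g & f = j \o g.
Proof.
move=> [injf dimf] [injj dimj] fj.
have /fin_all_exists[g fg] : forall q, exists s, f q = j s.
  by move=> q; exact/codomP.
have fE : f = j \o g by apply: funext.
exists g => //; split=> [q q' gq|q]; first by apply: injf; rewrite fE /= gq.
by rewrite -dimj -dimf fE.
Qed.

Definition arity_bound := (\max_g #|reg (gate_sys (G g))|)%N.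

Definition dim_bound (S : system) := (\max_(i : reg S) rdim i)%N.

Definition gate_dim_bound := (\max_g dim_bound (gate_sys (G g)))%N.

(** S collects the registers touched by some gate. Restriction is claimed for every subsystem
    containing S because the input and output registers are adjoined later. *)
Lemma circuit_support (W : system) m V : circuit G m V ->
  exists S : {set reg W}, [/\ (#|S| <= m * arity_bound)%N,
    forall w, w \in S -> (rdim w <= gate_dim_bound)%N &
    forall (W' : system) (j : reg W' -> reg W), placement j ->
      (forall w, w \in S -> w \in codom j) ->
      exists2 V', circuit G m V' & V *m zero_ext R j = zero_ext R j *m V'].
Proof.
elim=> {m V} [|m V g pos ppos _ [S [cardS dimS restr]]].
  exists finset.set0; split=> [|w|W' j pj _]; first by rewrite cards0.
    by rewrite inE.
  by exists 1%:M; [exact: circuit_nil|rewrite mul1mx mulmx1].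
exists (S :|: [set pos i | i in [set: reg (gate_sys (G g))]])%SET; split.
- rewrite mulSn addnC (leq_trans (leq_of_leqif (leq_card_setU _ _))) //.
  rewrite leq_add // (leq_trans (leq_imset_card _ _)) // cardsT.
  exact: (@leq_bigmax _ (fun g => #|reg (gate_sys (G g))|)).
- move=> w; rewrite inE => /orP[/dimS //|/imsetP[i _ ->]]; rewrite ppos.2.
  apply: (@leq_trans (dim_bound (gate_sys (G g)))).
    exact: (@leq_bigmax _ (fun i : reg (gate_sys (G g)) => rdim i)).
  exact: (@leq_bigmax _ (fun g => dim_bound (gate_sys (G g)))).
move=> W' j pj Sj.
have [|V' cV' VV'] := restr W' j pj.
  by move=> w wS; apply: Sj; rewrite inE wS.
have [|pos' ppos' posE] := placement_factor ppos pj.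
  by move=> q; apply: Sj; rewrite inE imset_f ?orbT.
exists (place pos' (gate_mx (G g)) *m V'); first exact: circuit_cons.
by rewrite -mulmxA VV' mulmxA posE place_zero_ext // mulmxA.
Qed.

(* Dimensions are shifted by one, which makes them positive. *)
Definition qudits (N D : nat) (d : {ffun 'I_N -> 'I_D.+1}) : system :=
  @System 'I_N (fun i => (d i).+1) (fun=> isT).

Lemma qudits_placement (W : system) (S : {set reg W}) (D : nat) :
  (forall w, w \in S -> (rdim w <= D)%N) ->
  exists (d : {ffun 'I_#|S| -> 'I_D.+1}) (j : reg (qudits d) -> reg W),
    placement j /\ forall w, w \in S -> w \in codom j.
Proof.
move=> dimS.
(* The predecessor compensates the shift in [qudits]; it loses nothing since dimensions are
   positive. *)
exists [ffun k => inord (rdim (enum_val k : reg W)).-1], (@enum_val _ (mem S)).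
split=> [|w wS]; last first.
  by apply/codomP; exists (enum_rank_in wS w); rewrite enum_rankK_in.
split=> [|k]; first exact: enum_val_inj.
rewrite /= ffunE inordK ?prednK ?rdim_gt0 //.
by rewrite (leq_trans (dimS _ (enum_valP k))).
Qed.

Lemma finite_circuits (W : system) m : finite_set [set V | @circuit R I G W m V].
Proof.
elim: m => [|m IHm].
  apply: (@sub_finite_set _ _ [set 1%:M]); last exact: finite_set1.
  by move=> V /= cV; inversion cV.
pose X := {g : I & {ffun reg (gate_sys (G g)) -> reg W}}.
pose step (V : 'M[R[i]]_(hdim W)) (x : X) := place (tagged x) (gate_mx (G (tag x))) *m V.
apply: (@sub_finite_set _ _
  (\bigcup_(V in [set V | circuit G m V]) [set step V x | x in [set: X]])).
  move=> V /= cV; inversion cV as [|m' U g pos ppos cU]; subst; exists U => //.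
  exists (Tagged (fun g => {ffun reg (gate_sys (G g)) -> reg W}) [ffun i => pos i]) => //.
  rewrite /step /=; congr (place _ _ *m _); apply: funext => i; exact: ffunE.
apply: bigcup_finite => // V _; apply: finite_image; exact: finite_finset.
Qed.

Context (A B : system).

(** Dimensions and positions are finite functions, so both unions have finite index sets. *)
Definition canonical_runs (N D m : nat) :
    set ('M[R[i]]_(hdim B) -> 'M[R[i]]_(hdim A)) :=
  \bigcup_(d in [set: {ffun 'I_N -> 'I_D.+1}])
  \bigcup_(f in [set: {ffun reg B -> 'I_N} * {ffun reg A -> 'I_N}])
    [set @run R A B (qudits d) f.1 f.2 V | V in [set V | circuit G m V]].

Lemma finite_canonical_runs N D m : finite_set (canonical_runs N D m).
Proof.
apply: bigcup_finite => [|d _]; first exact: finite_finset.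
apply: bigcup_finite => [|f _]; first exact: finite_finset.
by apply: finite_image; exact: finite_circuits.
Qed.

Lemma implementable_canonical
    (T : {linear 'M[R[i]]_(hdim B) -> 'M[R[i]]_(hdim A)}) m :
  implementable G T m ->
  exists2 N, (N <= m * arity_bound + (#|reg B| + #|reg A|))%N &
    canonical_runs N (maxn gate_dim_bound (maxn (dim_bound B) (dim_bound A))) m T.
Proof.
set D := maxn _ _.
move=> /implementable_run[W [phi [psi [V [pphi ppsi cV TE]]]]].
have [S [cardS dimS restr]] := circuit_support cV.
pose SB := [set phi i | i in [set: reg B]]%SET.
pose SA := [set psi i | i in [set: reg A]]%SET.
(* The registers to keep: those touched by a gate, the inputs and the outputs. *)
pose S' := (S :|: (SB :|: SA))%SET.
exists #|S'|.
  rewrite (leq_trans (leq_of_leqif (leq_card_setU _ _))) // leq_add //.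
  rewrite (leq_trans (leq_of_leqif (leq_card_setU _ _))) // -!cardsT.
  by rewrite leq_add ?leq_imset_card.
have [|d [j [pj Sj]]] := @qudits_placement W S' D.
  move=> w; rewrite !inE /D !leq_max => /or3P[/dimS -> //|/imsetP[i _ ->]|/imsetP[i _ ->]].
    by rewrite pphi.2 (@leq_bigmax _ (fun i : reg B => rdim i)) orbT.
  by rewrite ppsi.2 (@leq_bigmax _ (fun i : reg A => rdim i)) !orbT.
have [|V' cV' VV'] := restr _ j pj.
  by move=> w wS; apply: Sj; rewrite inE wS.
have [|phi' _ phiE] := placement_factor pphi pj.
  by move=> q; apply: Sj; rewrite !inE imset_f ?orbT.
have [|psi' _ psiE] := placement_factor ppsi pj.
  by move=> q; apply: Sj; rewrite !inE imset_f ?orbT.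
exists d => //; exists ([ffun i => phi' i], [ffun i => psi' i]) => //.
exists V' => //; apply: funext => rho; rewrite TE phiE psiE (run_zero_ext _ _ pj VV').
have run_eq f f' g g' : f = f' -> g = g' ->
  @run R A B (qudits d) f g V' rho = run f' g' V' rho by move=> -> ->.
by apply: run_eq; apply: funext => i; rewrite ffunE.
Qed.

Lemma finite_efficient (p : {poly R}) (n : nat) :
  finite_set [set (T : 'M[R[i]]_(hdim B) -> 'M[R[i]]_(hdim A)) |
              T in efficient G p n B A].
Proof.
(* Complexity is an infimum, so the slack of 1 yields an actual gate count strictly below p(n) +
   1. *)
have [m0 m0P] : exists m0 : nat, p.[n%:R] + 1 <= m0%:R.
  exists (Num.trunc (p.[n%:R] + 1)).+1; apply/ltW; exact: truncnS_gt.
pose N0 := (m0 * arity_bound + (#|reg B| + #|reg A|))%N.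
pose D := maxn gate_dim_bound (maxn (dim_bound B) (dim_bound A)).
apply: (@sub_finite_set _ _ (\bigcup_(m in [set m | (m < m0)%N])
  \bigcup_(N in [set N | (N < N0.+1)%N]) canonical_runs N D m)).
  move=> _ [T [_ Tp] <-].
  have [|x [m impl <-]] := @ereal_inf_lt _ _ (p.[n%:R] + 1)%:E (le_lt_trans Tp _).
    by rewrite lte_fin ltrDl.
  rewrite lte_fin => mp.
  have mm0 : (m < m0)%N by rewrite -(ltr_nat R) (lt_le_trans mp).
  exists m => //; have [N NN0 TN] := implementable_canonical impl.
  exists N => //; rewrite /= ltnS (leq_trans NN0) // leq_add2r.
  by rewrite leq_mul2r (ltnW mm0) orbT.
apply: bigcup_finite => [|m _]; first exact: finite_II.
apply: bigcup_finite => [|N _]; first exact: finite_II.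
exact: finite_canonical_runs.
Qed.
End Finiteness.

(** * Attainment of the maximum *)

Lemma finite_set_max (R : realType) (E : set R) :
  finite_set E -> (E !=set0)%classic -> exists M, E M /\ ubound E M.
Proof.
move=> /finite_seqP[s ->] [x xs].
exists (\big[Order.max/x]_(y <- s) y); split=> [|y /= ys].
  rewrite /= big_seq; apply: (big_ind (fun z => z \in s)) => // a b as_ bs.
  by rewrite /Order.max; case: ifP.
exact: le_bigmax_seq.
Qed.

Theorem mainTheorem1 (R : realType) (I : finType) (G : I -> gate R)
    (p : {poly R}) (n : nat) (A B : system)
    (hIC : informationally_complete G p n A B)
    (rho : 'M[R[i]]_(hdim A * hdim B)) (hrho : density rho) :
  exists M : R,
    [/\ [set fidelity T rho | T in efficient G p n B A] M,
        ubound [set fidelity T rho | T in efficient G p n B A] M &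
        cHmin G p n rho = (- log2 ((hdim A)%:R * M))%E].
Proof.
have [rho0 tr1] := hrho.
have [|T effT Tne0] := choi_separates hIC (rho := rho).
  by rewrite tr1 oner_neq0.
have TM : [set fidelity T rho | T in efficient G p n B A] (fidelity T rho) by exists T.
have [||M [ME Mub]] := @finite_set_max R [set fidelity T rho | T in efficient G p n B A].
(* Fidelity depends only on the underlying function of T, so its values are the image of a finite
   set. *)
- pose fid (f : 'M[R[i]]_(hdim B) -> 'M[R[i]]_(hdim A)) :=
    complex.Re ((map_mx Num.conj (Omega R (hdim A))^T *m id_tens f rho *m
                 Omega R (hdim A)) 0 0).
  apply: sub_finite_set (finite_image fid (finite_efficient G A B p n)).
  by move=> _ [S effS <-]; exists S => //; exists S.
- by exists (fidelity T rho).
exists M; split=> //; apply: cHmin_max_fidelity => //.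
(* M is positive because the separating channel T has nonzero, hence positive, fidelity. *)
apply: lt_le_trans (Mub _ TM); rewrite lt_def fidelity_ge0 //; last by case: effT.
rewrite andbT; apply: contra Tne0 => /eqP F0.
by rewrite tr_choi_fidelity ?F0 ?mulr0 //; case: effT.
Qed.
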